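(* Let $f:\mathbb{R}^n\to\mathbb{R}$ be twice continuously differentiable. Suppose there exist $R\in\mathbb{N}$ and polynomials $p_R(\alpha)=\sum_{i=0}^{R}a_i\alpha^i$ and $q_{R+1}(\alpha)=\sum_{i=0}^{R+1}b_i\alpha^i$ of degree $R$ and $R+1$, respectively, with $b_{R+1}>0$, such that for all $x\in\mathbb{R}^n$ $$\|\nabla^2 f(x)\|_F\le p_R(\|x\|)\quad\text{and}\quad \|\nabla f(x)\|\ge q_{R+1}(\|x\|).$$ Then, for any $L_1>0$ there exists an $L_0>0$ such that $f$ is $(L_0,L_1)$-smooth.
   Context: $\|\cdot\|$ is the Euclidean norm on vectors and the spectral norm on matrices; $\|\cdot\|_F$ is the Frobenius norm. A twice continuously differentiable function $f:\mathbb{R}^n\to\mathbb{R}$ is $(L_0,L_1)$-smooth, with $L_0,L_1\ge 0$, if $\|\nabla^2 f(x)\|\le L_0+L_1\|\nabla f(x)\|$ for all $x\in\mathbb{R}^n$. *)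

(* Defs.v *)
From HB Require Import structures.
From mathcomp Require Export all_boot all_order all_algebra.
From mathcomp Require Export boolp classical_sets functions reals.
From mathcomp Require Export topology normedtype derive.

Set Implicit Arguments.
Unset Strict Implicit.
Unset Printing Implicit Defensive.

Export Order.TTheory GRing.Theory Num.Theory.
Export numFieldNormedType.Exports.

Local Open Scope classical_set_scope.
Local Open Scope ring_scope.

Section Norms.
Variable R : realType.

(* The library's norm on 'rV[R]_n and 'M[R]_(m, n) is the max norm; it is used
   only through the topology (continuity, differentiability) it induces. *)
Definition enorm n (v : 'rV[R]_n) : R := Num.sqrt (\sum_(i < n) v 0 i ^+ 2).

Definition frob_norm m n (A : 'M[R]_(m, n)) : R :=
  Num.sqrt (\sum_(i < m) \sum_(j < n) A i j ^+ 2).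

(* Operator norm induced by enorm, for matrices acting on row vectors by right
   multiplication (the convention of 'J); transposing A does not change it. *)
Definition spectral_norm m n (A : 'M[R]_(m, n)) : R :=
  sup [set enorm (v *m A) | v in [set v : 'rV[R]_m | enorm v <= 1]].

End Norms.

Section Smoothness.
Variables (R : realType) (n : nat).
Implicit Types f : 'rV[R]_n -> R.

Definition gradient f (x : 'rV[R]_n) : 'rV[R]_n :=
  \row_(i < n) 'D_(delta_mx 0 i) f x.

(* The (i, j) entry is the i-th partial derivative of the j-th one. *)
Definition hessian f (x : 'rV[R]_n) : 'M[R]_n := 'J (gradient f) x.

Definition twice_continuously_differentiable f : Prop :=
  [/\ forall x, differentiable f x,
      forall x, differentiable (gradient f) x
    & continuous (hessian f)].

Definition L0L1_smooth (L0 L1 : R) f : Prop :=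
  [/\ 0 <= L0, 0 <= L1, twice_continuously_differentiable f
    & forall x,
        spectral_norm (hessian f x) <= L0 + L1 * enorm (gradient f x)].

End Smoothness.

(* Main.v *)
Require Import Defs.
From mathcomp Require Import ring lra polyrcf.

Local Open Scope ring_scope.

(** Writing [r] for the norm of [x], the spectral norm of the Hessian is at most
its Frobenius norm, hence at most [p r], while [L1] times the norm of the
gradient is at least [L1 * q r].  So any upper bound on [p - L1 * q] over
nonnegative reals can serve as [L0].  Such a bound exists because [q] has larger
degree than [p] and a positive leading coefficient: however small [L1 > 0] is,
[L1 * q - p] has positive leading coefficient, so it is positive far out
([poly_ge_lbound]), and it is bounded on the compact interval that remains.

The comparison of the two matrix norms ([spectral_norm_le_frob]) is the
Cauchy-Schwarz inequality ([sum_mul_sqr_le]) applied to each column. *)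

(** Lagrange's identity: twice the gap between the two sides is the sum of the
squares of all the minors [a i * b j - a j * b i]. *)
Lemma sum_mul_sqr_le (K : realDomainType) (I : finType) (a b : I -> K) :
  (\sum_i a i * b i) ^+ 2 <= (\sum_i a i ^+ 2) * (\sum_i b i ^+ 2).
Proof.
set A := \sum_i a i ^+ 2; set B := \sum_i b i ^+ 2; set C := \sum_i a i * b i.
suff gapE : \sum_i \sum_j (a i * b j - a j * b i) ^+ 2 = (A * B - C ^+ 2) *+ 2.
  rewrite -subr_ge0 -(pmulrn_lge0 _ (ltn0Sn 1)) -gapE.
  by apply: sumr_ge0 => i _; apply: sumr_ge0 => j _; exact: sqr_ge0.
have rowE i : \sum_j (a i * b j - a j * b i) ^+ 2
    = a i ^+ 2 * B + (b i ^+ 2 * A - (a i * b i) * (C *+ 2)).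
  rewrite /A /B /C -sumrMnl !mulr_sumr -sumrB -big_split /=.
  by apply: eq_bigr => j _; ring.
rewrite (eq_bigr _ (fun i _ => rowE i)) big_split sumrB /= -!mulr_suml.
by rewrite -/A -/B -/C; ring.
Qed.

Lemma enorm_mulmx_le (R : realType) (m n : nat) (v : 'rV[R]_m)
    (A : 'M[R]_(m, n)) :
  enorm (v *m A) <= enorm v * frob_norm A.
Proof.
rewrite /enorm /frob_norm -sqrtrM; last first.
  by apply: sumr_ge0 => i _; exact: sqr_ge0.
apply: ler_wsqrtr; rewrite exchange_big mulr_sumr /=.
by apply: ler_sum => j _; rewrite mxE; exact: sum_mul_sqr_le.
Qed.

Lemma spectral_norm_le_frob (R : realType) (m n : nat) (A : 'M[R]_(m, n)) :
  spectral_norm A <= frob_norm A.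
Proof.
apply: ge_sup.
  exists (enorm (0 *m A)), 0 => //=.
  by rewrite /enorm big1 ?sqrtr0 // => i _; rewrite mxE expr0n.
move=> _ [v /= v1 <-]; apply: le_trans (enorm_mulmx_le _ _ _ _ _) _.
by apply: ler_piMl v1; exact: sqrtr_ge0.
Qed.

Lemma poly_ge_lbound (F : rcfType) (g : {poly F}) (a : F) :
  0 < lead_coef g -> exists M, forall x, a <= x -> - M <= g.[x].
Proof.
move=> /[dup] g_gt0 /poly_pinfty_gt_lc[k gk].
have [M gM] := poly_itv_bound g a k.
exists `|M| => x ax; have [kx|/ltW xk] := leP k x.
  apply: le_trans (le_trans (ltW g_gt0) (gk x kx)).
  by rewrite oppr_le0.
have /gM : a <= x <= k by rewrite ax.
by rewrite ler_norml => /andP[+ _]; apply: le_trans; rewrite lerN2 ler_norm.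
Qed.

(** The higher-degree polynomial absorbs [p] far out, whatever the factor [c];
the constant [L] pays for the bounded range where it does not yet do so. *)
Lemma poly_le_cst_add_scale (F : rcfType) (p q : {poly F}) (c : F) :
  (size p < size q)%N -> 0 < lead_coef q -> 0 < c ->
  exists2 L, 0 < L & forall x, 0 <= x -> p.[x] <= L + c * q.[x].
Proof.
move=> ltpq q_gt0 c_gt0.
have lc_gt0 : 0 < lead_coef (c *: q - p).
  by rewrite lead_coefDl ?lead_coefZ ?mulr_gt0 // size_polyN size_scale ?gt_eqF.
have [M gM] := poly_ge_lbound _ _ 0 lc_gt0.
exists (`|M| + 1) => [|x /gM]; first by rewrite ltr_wpDl.
rewrite !hornerE => gx; have := ler_norm M; lra.
Qed.

Theorem theorem2p9 (R : realType) (n : nat) (f : 'rV[R]_n -> R)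
  (fC2 : twice_continuously_differentiable f)
  (fbounds : exists (d : nat) (p q : {poly R}),
    [/\ size p = d.+1, size q = d.+2, 0 < q`_d.+1
      & forall x : 'rV[R]_n,
          frob_norm (hessian f x) <= p.[enorm x] /\
          q.[enorm x] <= enorm (gradient f x)]) :
  forall L1 : R, 0 < L1 -> exists L0 : R, 0 < L0 /\ L0L1_smooth L0 L1 f.
Proof.
case: fbounds => d [p [q [sp sq q_gt0 pq]]] L1 L1_gt0.
have [| |L0 L0_gt0 pqL0] := poly_le_cst_add_scale _ p q L1 _ _ L1_gt0.
- by rewrite sp sq.
- by rewrite lead_coefE sq.
exists L0; split=> //; split=> // [||x]; [exact: ltW..|].
have [Hp qG] := pq x.
apply: le_trans (spectral_norm_le_frob _ _ _ _) _; apply: le_trans Hp _.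
apply: le_trans (pqL0 _ (sqrtr_ge0 _)) _.
by rewrite lerD2l ler_pM2l.
Qed.
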